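(* Let $d \geq 0$ as well as $k, m \geq 2$ be integers. If $m \geq k + 6 d - 3$, then $$L_{2 d + 1} (k, m) = f^{(k + 2 d, k, 1^{m - 2 d})} + \sum_{r = 0}^{d - 1} \sum_{j = 0}^r f^{(m - 2 (r + j + 1),\, k + 2 r + 1,\, k + 2 j + 1)},$$ where $L_{2d+1}(k,m) = \sum_{j=0}^{2d} f^{(k+j,k+j,1^{m-2j})}$.
   Context: For a partition $\lambda\vdash n$, $f^\lambda$ denotes the number of standard Young tableaux of shape $\lambda$; equivalently, $f^\lambda$ is the degree of the irreducible complex character of the symmetric group $\Sigma_n$ labeled by $\lambda$. In $(a,b,1^t)$ the notation $1^t$ means $t$ parts equal to $1$ (none if $t=0$). Empty sums are zero. *)

(* Defs.v *)
From mathcomp Require Import all_boot.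

Set Implicit Arguments.
Unset Strict Implicit.
Unset Printing Implicit Defensive.

(* A partition is given by the sequence of its parts, in weakly
   decreasing order. *)

(* Cells of the Young diagram of [sh], in matrix coordinates counted from 0. *)
Definition cell (sh : seq nat) := {i : 'I_(size sh) & 'I_(nth 0 sh i)}.

Definition cell_row (sh : seq nat) (c : cell sh) : nat := tag c.
Definition cell_col (sh : seq nat) (c : cell sh) : nat := tagged c.

(* The entries are 0, ..., n - 1 instead of 1, ..., n, where n = sumn sh is also
   the number of cells: injectivity makes each entry occur exactly once. *)
Definition standard (sh : seq nat) (T : {ffun cell sh -> 'I_(sumn sh)}) : bool :=
  [&& injectiveb T,
      [forall x, forall y,
         (cell_row x == cell_row y) && (cell_col x < cell_col y)
         ==> (T x < T y)]
    & [forall x, forall y,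
         (cell_col x == cell_col y) && (cell_row x < cell_row y)
         ==> (T x < T y)]].

Definition nb_syt (sh : seq nat) : nat :=
  #|[set T : {ffun cell sh -> 'I_(sumn sh)} | standard T]|.

(* L_odd d is L_{2d+1}: the argument is d, not the subscript 2d+1. *)
Definition L_odd (d k m : nat) : nat :=
  \sum_(0 <= j < (2 * d).+1)
    nb_syt [:: k + j, k + j & nseq (m - 2 * j) 1].

(* Main.v *)
Require Import Defs.
From mathcomp Require Import all_boot all_order all_algebra zify ring lra.

(* Removing the cell with the largest entry gives the branching rule, and hence,
   by induction, the hook length formulas for the shapes (a, b, c) and
   (x, y, 1^t). Write g(x, y, t) for the second one. The rational identity
     g(b-1, c-1, a+2) - g(b+1, c-1, a) - g(b-1, c+1, a) + g(b+1, c+1, a-2)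
       = f^(a, b, c)
   telescopes when summed over c = k+1, k+3, ..., b with b = k+2d+1 and a + c
   fixed; since g(b-1, b+1, t) = - g(b, b, t), the boundary terms left over are
   exactly the increment of the claimed equality from d to d+1. *)

Set Implicit Arguments.
Unset Strict Implicit.
Unset Printing Implicit Defensive.

(** * Linear extensions of a relation on a finite set *)

Section LinearExtensions.
Variables (X : finType) (r : rel X) (n : nat) (z : 'I_n).

(* The value [z] outside [A] is a dummy: it lets the extensions of all subsets
   of [X] live in the same type. *)
Definition linext (A : {set X}) (T : {ffun X -> 'I_n}) : bool :=
  [&& [forall x in A, T x < #|A|],
      [forall (x | x \notin A), T x == z],
      [forall x in A, forall y in A, (T x == T y) ==> (x == y)]
    & [forall x in A, forall y in A, r x y ==> (T x < T y)]].

Definition nb_linext (A : {set X}) : nat := #|[set T | linext A T]|.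

Lemma linextP (A : {set X}) (T : {ffun X -> 'I_n}) :
  reflect [/\ forall x, x \in A -> T x < #|A|,
              forall x, x \notin A -> T x = z,
              {in A &, injective T}
            & {in A &, forall x y, r x y -> T x < T y}]
          (linext A T).
Proof.
apply: (iffP and4P) => -[H1 H2 H3 H4].
- split.
  + by move=> x xA; move/forall_inP: H1 => /(_ x xA).
  + by move=> x xA; move/forall_inP: H2 => /(_ x xA)/eqP.
  + move=> x y xA yA Txy.
    by move/forall_inP: H3 => /(_ x xA)/forall_inP/(_ y yA); rewrite Txy eqxx => /eqP.
  + move=> x y xA yA rxy.
    by move/forall_inP: H4 => /(_ x xA)/forall_inP/(_ y yA)/implyP; apply.
- split.
  + exact/forall_inP.
  + by apply/forall_inP => x xA; rewrite H2.
  + apply/forall_inP => x xA; apply/forall_inP => y yA.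
    by apply/implyP => /eqP /H3 ->.
  + apply/forall_inP => x xA; apply/forall_inP => y yA.
    by apply/implyP; apply: H4.
Qed.

Lemma nb_linext0 : nb_linext set0 = 1.
Proof.
apply/eqP/cards1P; exists [ffun => z]; apply/setP => T; rewrite !inE.
apply/linextP/eqP => [[_ Tz _ _]|->].
  by apply/ffunP => x; rewrite ffunE Tz ?inE.
by split=> [x|x|x y|x y]; rewrite ?inE // ffunE.
Qed.

(** Pigeonhole: [T] is injective on [A] with values below [#|A|], so each of them is attained. *)
Lemma linext_surj (A : {set X}) T i :
  linext A T -> i < #|A| -> exists2 x, x \in A & T x = i :> nat.
Proof.
move=> /linextP[Tlt _ Tinj _] iA.
have [|||_ /(_ i)] := @uniq_min_size _ [seq val (T x) | x <- enum A] (iota 0 #|A|).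
- rewrite map_inj_in_uniq ?enum_uniq // => x y; rewrite !mem_enum => xA yA.
  by move/val_inj; apply: Tinj.
- by move=> _ /mapP[x xA ->]; rewrite mem_iota /= add0n Tlt // -mem_enum.
- by rewrite size_iota size_map -cardE.
rewrite mem_iota add0n iA => /mapP[x]; rewrite mem_enum => xA ->.
by exists x.
Qed.

Definition maximal_in (A : {set X}) (x : X) : bool :=
  (x \in A) && [forall y in A, ~~ r x y].

(** Resetting the value at [x] to the dummy [z] is inverse to [ext], which puts the top value at
    [x]; maximality of [x] keeps the result of [ext] monotone. *)
Lemma linext_last (A : {set X}) (x : X) :
  irreflexive r -> #|A| <= n -> maximal_in A x ->
  #|[set T | linext A T & T x == #|A|.-1 :> nat]| = nb_linext (A :\ x).
Proof.
move=> rI An /andP[xA xmax].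
have cA : #|A| = #|A :\ x|.+1 by rewrite (cardsD1 x A) xA.
have iP : #|A :\ x| < n by rewrite -cA.
pose ext (T : {ffun X -> 'I_n}) : {ffun X -> 'I_n} :=
  [ffun y => if y == x then Ordinal iP else T y].
rewrite /nb_linext -[RHS](card_in_imset (f := ext)); last first.
  move=> T U; rewrite !inE => /linextP[_ Tz _ _] /linextP[_ Uz _ _] TU.
  apply/ffunP => y; have [->|yx] := eqVneq y x.
    by rewrite Tz ?Uz ?inE ?eqxx.
  by move/ffunP: TU => /(_ y); rewrite !ffunE (negbTE yx).
apply: eq_card => T; rewrite inE; apply/andP/imsetP.
- move=> [/linextP[Tlt Tz Tinj Tmono] /eqP Tx].
  exists [ffun y => if y == x then z else T y]; last first.
    apply/ffunP => y; rewrite !ffunE; case: eqP => // ->.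
    by apply: val_inj; rewrite /= Tx cA.
  rewrite inE; apply/linextP; split.
  + move=> y; rewrite !inE ffunE => /andP[yx yA]; rewrite (negbTE yx).
    have := Tlt y yA; rewrite cA ltnS leq_eqVlt => /orP[/eqP Ty|//].
    case/negP: yx; apply/eqP; apply: Tinj => //; apply: val_inj.
    by rewrite /= Tx Ty cA.
  + move=> y; rewrite !inE ffunE; case: eqP => //= _; exact: Tz.
  + move=> y y'; rewrite !inE !ffunE => /andP[yx yA] /andP[yx' yA'].
    by rewrite (negbTE yx) (negbTE yx'); apply: Tinj.
  + move=> y y'; rewrite !inE !ffunE => /andP[yx yA] /andP[yx' yA'].
    by rewrite (negbTE yx) (negbTE yx'); apply: Tmono.
- move=> [U]; rewrite inE => /linextP[Ult Uz Uinj Umono] ->.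
  have ltU y : y \in A -> y != x -> U y < #|A :\ x|.
    by move=> yA yx; apply: Ult; rewrite !inE yx.
  split; last by rewrite ffunE eqxx /= cA.
  apply/linextP; split.
  + move=> y yA; rewrite ffunE cA ltnS; case: eqVneq => //= yx.
    exact/ltnW/ltU.
  + move=> y yA; rewrite ffunE; case: eqVneq => [yx|yx].
      by rewrite yx xA in yA.
    by apply: Uz; rewrite !inE (negbTE yA) andbF.
  + move=> y y' yA yA'; rewrite !ffunE.
    case: eqVneq => [->|yx]; case: eqVneq => [->|yx'] // /(congr1 val) /= E.
    * by have := ltU _ yA' yx'; rewrite -E ltnn.
    * by have := ltU _ yA yx; rewrite E ltnn.
    * by apply: Uinj; rewrite ?inE ?yx ?yx' //; apply: val_inj.
  + move=> y y' yA yA' ry; rewrite !ffunE.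
    case: eqVneq => [yx|yx]; case: eqVneq => [yx'|yx'].
    * by rewrite yx yx' rI in ry.
    * by rewrite yx in ry; have /forall_inP/(_ y' yA') := xmax; rewrite ry.
    * exact: ltU.
    * by apply: Umono; rewrite ?inE ?yx ?yx'.
Qed.

(** Each linear extension takes its top value at exactly one point of [A], necessarily a maximal
    one; the extensions are sorted by that point. *)
Lemma nb_linext_rec (A : {set X}) :
  irreflexive r -> #|A| <= n -> A != set0 ->
  nb_linext A = \sum_(x | maximal_in A x) nb_linext (A :\ x).
Proof.
move=> rI An A0; have cA : 0 < #|A| by rewrite card_gt0.
under eq_bigr => x xmax do rewrite -linext_last // -sum1_card.
rewrite /nb_linext -sum1_card.
under [RHS]eq_bigr => x xmax.
  rewrite (eq_bigl (fun T => linext A T && (T x == #|A|.-1 :> nat))); last first.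
    by move=> T; rewrite inE.
  over.
rewrite (exchange_big_dep (linext A)) /=; last by move=> x T _ /andP[].
rewrite (eq_bigl (linext A)); last by move=> T; rewrite inE.
apply: eq_bigr => T TA; have := TA => /linextP[Tlt _ Tinj Tmono].
have [|x xA Tx] := linext_surj (i := #|A|.-1) TA; first by rewrite ltn_predL.
rewrite (big_pred1 x) // => y; rewrite TA /=; apply/andP/eqP => [[]|->].
  move=> /andP[yA _] /eqP Ty; apply: Tinj => //; apply: val_inj.
  by rewrite /= Ty Tx.
rewrite Tx eqxx; split=> //; rewrite /maximal_in xA; apply/forall_inP => w wA.
apply/negP => /(Tmono _ _ xA wA); rewrite Tx ltnNge.
by rewrite -ltnS prednK // Tlt.
Qed.

End LinearExtensions.

(** * Branching rule for Young diagrams *)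

Section Branching.
Variable sh : seq nat.

Definition cell_lt : rel (cell sh) := fun x y =>
  (cell_row x == cell_row y) && (cell_col x < cell_col y)
  || (cell_col x == cell_col y) && (cell_row x < cell_row y).

Lemma cell_lt_irr : irreflexive cell_lt.
Proof. by move=> x; rewrite /cell_lt !ltnn !andbF. Qed.

Lemma cell_inj (x y : cell sh) :
  cell_row x = cell_row y -> cell_col x = cell_col y -> x = y.
Proof.
case: x => i a; case: y => j b; rewrite /cell_row /cell_col /= => /val_inj eij.
by subst j => /val_inj ->.
Qed.

Lemma cell_exists i j :
  j < nth 0 sh i -> exists x : cell sh, cell_row x = i /\ cell_col x = j.
Proof.
move=> hj; have hi : i < size sh.
  by rewrite ltnNge; apply/negP => /(nth_default 0) E; rewrite E in hj.
by exists (Tagged (fun i : 'I_(size sh) => 'I_(nth 0 sh i))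
                  (Ordinal hj : 'I_(nth 0 sh (Ordinal hi)))).
Qed.

Lemma cell_col_lt (x : cell sh) : cell_col x < nth 0 sh (cell_row x).
Proof. by case: x => i a; exact: ltn_ord. Qed.

Lemma card_cell : #|{: cell sh}| = sumn sh.
Proof.
rewrite card_tagged !sumnE big_map big_enum /= [RHS](big_nth 0) big_mkord.
by apply: eq_bigr => i _; rewrite card_ord.
Qed.

(** On the full set the bound by [#|A|] is automatic and the dummy condition is void, so any [z]
    serves. *)
Lemma nb_sytE (z : 'I_(sumn sh)) : nb_syt sh = nb_linext cell_lt z setT.
Proof.
apply: eq_card => T; rewrite !inE; apply/and3P/linextP.
- move=> [/injectiveP Tinj /forallP Trow /forallP Tcol]; split.
  + by move=> x _; rewrite cardsT card_cell.
  + by move=> x; rewrite inE.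
  + by move=> x y _ _; apply: Tinj.
  + move=> x y _ _ /orP[]; apply/implyP.
      by move/forallP: (Trow x).
    by move/forallP: (Tcol x).
- move=> [_ _ Tinj Tmono]; split.
  + by apply/injectiveP => x y; apply: Tinj; rewrite inE.
  + apply/forallP => x; apply/forallP => y; apply/implyP => xy.
    by apply: Tmono; rewrite ?inE // /cell_lt xy.
  + apply/forallP => x; apply/forallP => y; apply/implyP => xy.
    by apply: Tmono; rewrite ?inE // /cell_lt xy orbT.
Qed.

(* A partition is encoded by its function of parts [mu], zero beyond its
   length; [diagram mu] is its diagram as a set of cells of the larger [sh]. *)
Definition diagram (mu : nat -> nat) : {set cell sh} :=
  [set x | cell_col x < mu (cell_row x)].

Definition decr (mu : nat -> nat) (i : nat) : nat -> nat :=
  fun j => if j == i then (mu j).-1 else mu j.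

Lemma eq_diagram mu nu : mu =1 nu -> diagram mu = diagram nu.
Proof. by move=> E; apply/setP => x; rewrite !inE E. Qed.

Lemma diagramT : diagram (nth 0 sh) = setT.
Proof. by apply/setP => x; rewrite !inE cell_col_lt. Qed.

(** The maximal cells are the removable corners: a cell that is not last in its row has a right
    neighbour in the diagram, and one above an equally long row has a lower neighbour. *)
Lemma maximal_diagram mu (x : cell sh) :
  (forall i, mu i.+1 <= mu i) -> (forall i, mu i <= nth 0 sh i) ->
  maximal_in cell_lt (diagram mu) x =
  (mu (cell_row x).+1 < mu (cell_row x)) && (cell_col x == (mu (cell_row x)).-1).
Proof.
move=> mu_dec mu_sh; have mu_le i j : i <= j -> mu j <= mu i.
  move=> /subnK <-; elim: (j - i) => [|n IH]; first by rewrite add0n.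
  by rewrite addSn (leq_trans (mu_dec _) IH).
apply/andP/andP.
- rewrite inE => -[xmu /forall_inP xmax].
  have colx : cell_col x = (mu (cell_row x)).-1.
    apply/eqP; rewrite eqn_leq; apply/andP; split; first by lia.
    rewrite leqNgt; apply/negP => lt; have lt' : (cell_col x).+1 < mu (cell_row x) by lia.
    have [y [yr yc]] := cell_exists (leq_trans lt' (mu_sh _)).
    have := xmax y; rewrite inE yr yc => /(_ lt') /negP; case.
    by rewrite /cell_lt yr yc eqxx ltnSn.
  split; last by rewrite colx.
  rewrite ltnNge; apply/negP => le.
  have lt' : cell_col x < mu (cell_row x).+1 by lia.
  have [y [yr yc]] := cell_exists (leq_trans lt' (mu_sh _)).
  have := xmax y; rewrite inE yr yc => /(_ lt') /negP; case.
  by rewrite /cell_lt yr yc eqxx ltnSn orbT.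
- move=> [lt /eqP colx]; rewrite inE; split; first by lia.
  apply/forall_inP => y; rewrite inE => ymu; apply/negP => /orP[]/andP[/eqP E].
    by rewrite -E in ymu; lia.
  by move=> /mu_le; lia.
Qed.

Lemma diagram_decr mu (x : cell sh) :
  cell_col x = (mu (cell_row x)).-1 ->
  diagram mu :\ x = diagram (decr mu (cell_row x)).
Proof.
move=> colx; apply/setP => y; rewrite !inE /decr.
case: (eqVneq (cell_row y) (cell_row x)) => E.
  rewrite E; have -> : (y != x) = (cell_col y != cell_col x).
    congr (~~ _); apply/eqP/eqP => [->//|]; exact: cell_inj.
  by lia.
by have -> : y != x by apply: contraNneq E => ->.
Qed.

(** The ambient [sh] stays fixed while [mu] shrinks, so inductions on [mu] change neither the type
    of cells nor the dummy. *)
Definition nb_fill (z : 'I_(sumn sh)) (mu : nat -> nat) : nat :=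
  nb_linext cell_lt z (diagram mu).

Lemma branching (z : 'I_(sumn sh)) mu :
  (forall i, mu i.+1 <= mu i) -> (forall i, mu i <= nth 0 sh i) -> 0 < mu 0 ->
  nb_fill z mu =
  \sum_(i < size sh | mu i.+1 < mu i) nb_fill z (decr mu i).
Proof.
move=> mu_dec mu_sh mu0; rewrite /nb_fill nb_linext_rec.
(* A row holds at most one removable corner, so sorting by row leaves one term per strict descent of
   [mu]. *)
- rewrite (partition_big (fun x : cell sh => tag x) (fun i => mu i.+1 < mu i)).
    apply: eq_bigr => i lti.
    have [x [xr xc]] : exists x : cell sh,
        cell_row x = i /\ cell_col x = (mu i).-1.
      by apply: cell_exists; apply: leq_trans (mu_sh i); lia.
    rewrite (big_pred1 x) ?diagram_decr ?xr // => y.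
    rewrite maximal_diagram //.
    apply/andP/eqP => [[/andP[_ /eqP yc] /eqP yr]|->].
      have {}yr : cell_row y = i by rewrite /cell_row yr.
      by apply: cell_inj; [rewrite xr | rewrite xc yc yr].
    by rewrite xr lti xc eqxx; split=> //; apply/eqP/val_inj.
  by move=> x; rewrite maximal_diagram // => /andP[].
- exact: cell_lt_irr.
- by rewrite -card_cell max_card.
- have [x [xr xc]] := cell_exists (leq_trans mu0 (mu_sh 0)).
  by apply/set0Pn; exists x; rewrite inE xr xc.
Qed.

Lemma eq_nb_fill z mu nu : mu =1 nu -> nb_fill z mu = nb_fill z nu.
Proof. by move=> E; rewrite /nb_fill (eq_diagram E). Qed.

Lemma nb_fill0 z : nb_fill z (fun=> 0) = 1.
Proof.
rewrite /nb_fill (_ : diagram _ = set0) ?nb_linext0 //.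
Qed.

Lemma nb_fill_sh z mu : mu =1 nth 0 sh -> nb_fill z mu = nb_syt sh.
Proof. by move=> E; rewrite (nb_sytE z) /nb_fill (eq_diagram E) diagramT. Qed.

End Branching.

(** * Rational closed forms and their identities *)

Section ClosedForms.
Import Order.TTheory GRing.Theory Num.Theory.
Local Open Scope ring_scope.

(* Hook length formulas, also evaluated outside partitions: they vanish when a
   row is one cell shorter than the next, so the branching rule needs no case
   distinction. [near_hook] is only meaningful for [0 < y]. *)
Definition three_row (a b c : nat) : rat :=
  (a + b + c)`!%:R * (a%:R - b%:R + 1) * (a%:R - c%:R + 2) * (b%:R - c%:R + 1)
  / (a.+2`!%:R * b.+1`!%:R * c`!%:R).

Definition near_hook (x y t : nat) : rat :=
  (x + y + t)`!%:R * (x%:R - y%:R + 1)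
  / (x`!%:R * y.-1`!%:R * t`!%:R * (y + t)%:R * (x + t + 1)%:R).

Lemma factr_gt0 n : 0 < n`!%:R :> rat.
Proof. by rewrite ltr0n fact_gt0. Qed.

Lemma factrS n : n.+1`!%:R = (n%:R + 1) * n`!%:R :> rat.
Proof. by rewrite factS natrM -natr1. Qed.

Ltac nonzero := repeat (apply/andP; split); apply: lt0r_neq0; lra.

Lemma three_row_rec a b c :
  three_row a.+1 b.+1 c.+1
  = three_row a b.+1 c.+1 + three_row a.+1 b c.+1 + three_row a.+1 b.+1 c.
Proof.
(* All factorials are reduced to those of [a + b + c], [a], [b], [c]; generalised to positive
   rationals, these leave an identity of rational functions. *)
rewrite /three_row !(addSn, addnS) !factrS -!natr1 !natrD.
move: (factr_gt0 (a + b + c)) (factr_gt0 a) (factr_gt0 b) (factr_gt0 c).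
move: (ler0n rat a) (ler0n rat b) (ler0n rat c).
move: (_`!%:R) (_`!%:R) (_`!%:R) (_`!%:R) (a%:R) (b%:R) (c%:R).
move=> N A B C x y z *; field; nonzero.
Qed.

Lemma three_row_rec0 a b :
  three_row a.+1 b.+1 0 = three_row a b.+1 0 + three_row a.+1 b 0.
Proof.
rewrite /three_row !(addSn, addnS) !addn0 !factrS fact0 -!natr1 !natrD.
move: (factr_gt0 (a + b)) (factr_gt0 a) (factr_gt0 b).
move: (ler0n rat a) (ler0n rat b).
move: (_`!%:R) (_`!%:R) (_`!%:R) (a%:R) (b%:R).
move=> N A B x y *; field; nonzero.
Qed.

Lemma three_row00 a : three_row a 0 0 = 1.
Proof.
rewrite /three_row !addn0 !factrS fact0 -!natr1.
move: (factr_gt0 a) (ler0n rat a); move: (_`!%:R) (a%:R).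
move=> A x *; field; nonzero.
Qed.

Lemma three_row_ab a c : three_row a a.+1 c = 0.
Proof. by rewrite /three_row -natr1 (_ : _ + 1 = 0) ?(mulr0, mul0r) //; ring. Qed.

Lemma three_row_bc a b : three_row a b b.+1 = 0.
Proof.
by rewrite /three_row -natr1 (_ : b%:R - _ + 1 = 0) ?(mulr0, mul0r) //; ring.
Qed.

Lemma near_hook_rec x y t :
  near_hook x.+1 y.+2 t.+1
  = near_hook x y.+2 t.+1 + near_hook x.+1 y.+1 t.+1 + near_hook x.+1 y.+2 t.
Proof.
rewrite /near_hook /= !(addSn, addnS) !factrS -!natr1 !natrD.
move: (factr_gt0 (x + y + t)) (factr_gt0 x) (factr_gt0 y) (factr_gt0 t).
move: (ler0n rat x) (ler0n rat y) (ler0n rat t).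
move: (_`!%:R) (_`!%:R) (_`!%:R) (_`!%:R) (x%:R) (y%:R) (t%:R).
move=> N A B C a b c *; field; nonzero.
Qed.

Lemma near_hook_rec0 x y :
  near_hook x.+1 y.+2 0 = near_hook x y.+2 0 + near_hook x.+1 y.+1 0.
Proof.
rewrite /near_hook /= !(addSn, addnS) !addn0 !factrS fact0 -!natr1 !natrD.
move: (factr_gt0 (x + y)) (factr_gt0 x) (factr_gt0 y).
move: (ler0n rat x) (ler0n rat y).
move: (_`!%:R) (_`!%:R) (_`!%:R) (x%:R) (y%:R).
move=> N A B a b *; field; nonzero.
Qed.

(** With [y = 1] and a nonempty leg, the cell of the second row lies above another cell, so only the
    first row and the leg can shrink. *)
Lemma near_hook_rec1 x t :
  near_hook x.+1 1 t.+1 = near_hook x 1 t.+1 + near_hook x.+1 1 t.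
Proof.
rewrite /near_hook /= !(addSn, addnS) !addn0 !factrS fact0 -!natr1 !natrD.
move: (factr_gt0 (x + t)) (factr_gt0 x) (factr_gt0 t).
move: (ler0n rat x) (ler0n rat t).
move: (_`!%:R) (_`!%:R) (_`!%:R) (x%:R) (t%:R).
move=> N A B a b *; field; nonzero.
Qed.

(** The summand [1] counts the single row left when the second row disappears; there [near_hook]
    itself would have a zero denominator. *)
Lemma near_hook_rec10 x : near_hook x.+1 1 0 = near_hook x 1 0 + 1.
Proof.
rewrite /near_hook /= !(addSn, addnS) !addn0 !factrS fact0 -!natr1.
move: (factr_gt0 x) (ler0n rat x); move: (_`!%:R) (x%:R).
move=> A a *; field; nonzero.
Qed.

Lemma near_hook_xy x t : near_hook x x.+1 t = 0.
Proof. by rewrite /near_hook -natr1 (_ : _ + 1 = 0) ?(mulr0, mul0r) //; ring. Qed.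

(** Exchanging [x] and [y - 1] preserves the size and the denominator and flips the sign of
    [x - y + 1]; here [y = x + 2]. *)
Lemma near_hook_antisym x t : near_hook x x.+2 t = - near_hook x.+1 x.+1 t.
Proof.
rewrite /near_hook /= !(addSn, addnS) !factrS -!natr1 !natrD.
move: (factr_gt0 (x + x + t)) (factr_gt0 x) (factr_gt0 t).
move: (ler0n rat x) (ler0n rat t).
move: (_`!%:R) (_`!%:R) (_`!%:R) (x%:R) (t%:R).
move=> N A B a b *; field; nonzero.
Qed.

(** Parts are shifted by 2 to avoid truncated subtraction. All five terms have size [a + b + c + 6].
    The case [b = c], where the third term is not a partition, is used too. *)
Lemma near_hook_three_row a b c :
  near_hook b.+1 c.+1 a.+4 - near_hook b.+3 c.+1 a.+2
  - near_hook b.+1 c.+3 a.+2 + near_hook b.+3 c.+3 a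
  = three_row a.+2 b.+2 c.+2.
Proof.
rewrite /near_hook /three_row (_ : b.+1 + c.+1 + a.+4 = (a + b + c).+4.+2)%N; last by lia.
rewrite (_ : b.+3 + c.+1 + a.+2 = (a + b + c).+4.+2)%N; last by lia.
rewrite (_ : b.+1 + c.+3 + a.+2 = (a + b + c).+4.+2)%N; last by lia.
rewrite (_ : b.+3 + c.+3 + a = (a + b + c).+4.+2)%N; last by lia.
rewrite (_ : a.+2 + b.+2 + c.+2 = (a + b + c).+4.+2)%N; last by lia.
rewrite /= !(addSn, addnS) !factrS -!natr1 !natrD.
move: (factr_gt0 (a + b + c)) (factr_gt0 a) (factr_gt0 b) (factr_gt0 c).
move: (ler0n rat a) (ler0n rat b) (ler0n rat c).
move: (_`!%:R) (_`!%:R) (_`!%:R) (_`!%:R) (a%:R) (b%:R) (c%:R).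
move=> N A B C x y z *; field; nonzero.
Qed.

End ClosedForms.

(** * Tableau counts by induction on the number of cells *)

Section Counting.
Import Order.TTheory GRing.Theory Num.Theory.
Local Open Scope ring_scope.

(** An ambient shape with exactly three rows makes [branching] a sum of three terms, matched with
    the recursion for [three_row]. *)
Lemma nb_fill_three_row sh (z : 'I_(sumn sh)) a b c :
  size sh = 3 -> (c <= b <= a)%N ->
  (forall i, nth 0 [:: a; b; c] i <= nth 0 sh i)%N ->
  (nb_fill z (nth 0%N [:: a; b; c]))%:R = three_row a b c.
Proof.
move=> sh3; have [n] := ubnP (a + b + c)%N.
elim: n => // n IH in a b c *; rewrite ltnS => abc /andP[cb ba] le_sh.
case: a => [|a] in abc ba le_sh *.
  case: b ba cb {abc le_sh} => // _; case: c => // _.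
  rewrite three_row00 -[RHS](mulr1n 1) -(nb_fill0 z); congr (_%:R); apply: eq_nb_fill.
  by case=> [|[|[|i]]] //=; rewrite nth_nil.
(* The induction hypothesis for removal from each row, guarded so that a partition remains. *)
have Ha : (c <= b -> b <= a ->
    (nb_fill z (nth 0 [:: a; b; c]))%:R = three_row a b c)%N.
  move=> cb' ba'; apply: IH; [lia | lia |] => i.
  by apply: leq_trans (le_sh i); case: i => [|[|[|]]] //=.
have Hb b' : (b = b'.+1 -> c <= b' ->
    (nb_fill z (nth 0 [:: a.+1; b'; c]))%:R = three_row a.+1 b' c)%N.
  move=> eb cb'; apply: IH; [lia | lia |] => i.
  by apply: leq_trans (le_sh i); case: i => [|[|[|]]] //=; lia.
have Hc c' : (c = c'.+1 ->
    (nb_fill z (nth 0 [:: a.+1; b; c']))%:R = three_row a.+1 b c')%N.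
  move=> ec; apply: IH; [lia | lia |] => i.
  by apply: leq_trans (le_sh i); case: i => [|[|[|]]] //=; lia.
rewrite branching //; last first.
  by case=> [|[|[|i]]] //=; rewrite !nth_nil.
rewrite big_mkcond /= -(big_mkord xpredT (fun i => if
  (nth 0 [:: a.+1; b; c] i.+1 < nth 0 [:: a.+1; b; c] i)%N then
  nb_fill z (decr (nth 0%N [:: a.+1; b; c]) i) else 0%N)) sh3.
rewrite !big_nat_recl // big_geq //= addn0 ltnS.
have -> : nb_fill z (decr (nth 0%N [:: a.+1; b; c]) 0)
        = nb_fill z (nth 0%N [:: a; b; c]).
  by apply: eq_nb_fill; case=> [|[|[|]]].
have -> : nb_fill z (decr (nth 0%N [:: a.+1; b; c]) 1)
        = nb_fill z (nth 0%N [:: a.+1; b.-1; c]).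
  by apply: eq_nb_fill; case=> [|[|[|]]].
have -> : nb_fill z (decr (nth 0%N [:: a.+1; b; c]) 2)
        = nb_fill z (nth 0%N [:: a.+1; b; c.-1]).
  by apply: eq_nb_fill; case=> [|[|[|]]].
have TA : (if (b <= a)%N then nb_fill z (nth 0%N [:: a; b; c]) else 0%N)%:R
          = three_row a b c.
  case: ifP => [|/negbT]; first exact: Ha.
  rewrite -ltnNge => lt; have -> : b = a.+1 by lia.
  by rewrite three_row_ab.
rewrite !natrD TA.
(* Zero parts are treated apart: they have no predecessor, and their rows contribute no term. *)
case: b => [|b] in ba cb abc le_sh Ha Hb Hc TA *.
  by case: c cb {abc le_sh Ha Hb Hc TA} => // _; rewrite /= !three_row00 !addr0.
have TB : (if (c < b.+1)%N then nb_fill z (nth 0%N [:: a.+1; b.+1.-1; c]) else 0%N)%:R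
          = three_row a.+1 b c.
  case: ifP => [cb'|/negbT]; first exact: Hb.
  rewrite -leqNgt => lt; have -> : c = b.+1 by lia.
  by rewrite three_row_bc.
rewrite TB; case: c => [|c] in ba cb abc le_sh Ha Hb Hc TA TB *.
  by rewrite ltnn addr0 three_row_rec0.
by rewrite Hc // three_row_rec addrA.
Qed.

(** The dummy value exists only for a nonempty shape, whence [0 < a]. *)
Lemma nb_syt_three_row a b c :
  (0 < a)%N -> (c <= b <= a)%N -> (nb_syt [:: a; b; c])%:R = three_row a b c.
Proof.
move=> a0 cba; have n0 : (0 < sumn [:: a; b; c])%N by rewrite /=; lia.
by rewrite -(nb_fill_sh (Ordinal n0) (frefl _)) nb_fill_three_row.
Qed.

Lemma nb_fill_row sh (z : 'I_(sumn sh)) x :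
  (x <= nth 0 sh 0)%N -> nb_fill z (nth 0%N [:: x]) = 1%N.
Proof.
elim: x => [|x IH] le_sh.
  by rewrite -(nb_fill0 z); apply: eq_nb_fill; case=> [|i] //=; rewrite nth_nil.
rewrite branching //; first last.
- by case=> [|i] //=; rewrite nth_nil.
- by case=> [|i] //=; rewrite !nth_nil.
case: sh => [|s sh] // in z IH le_sh *.
rewrite big_mkcond big_ord_recl /= big1 => [|i _]; last by rewrite nth_nil.
rewrite addn0 -[RHS]IH; last exact: ltnW.
by apply: eq_nb_fill; case.
Qed.

Lemma nth_near_hook x y t i :
  nth 0 [:: x, y & nseq t 1%N] i =
  match i with 0 => x | 1 => y | j.+2 => (j < t)%N end.
Proof. by case: i => [|[|i]] //=; rewrite nth_nseq; case: ltnP. Qed.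

(** Corners can only occur at the ends of the first two rows and at the bottom of the leg, giving
    the three terms of the recursion. *)
Lemma nb_fill_near_hook sh (z : 'I_(sumn sh)) x y t :
  (0 < y <= x)%N ->
  (forall i, nth 0 [:: x, y & nseq t 1%N] i <= nth 0 sh i)%N ->
  (nb_fill z (nth 0%N [:: x, y & nseq t 1%N]))%:R = near_hook x y t.
Proof.
have [n] := ubnP (x + y + t)%N.
elim: n => // n IH in x y t *; rewrite ltnS => xyt /andP[y0 yx] le_sh.
case: x => [|x] in xyt yx le_sh *; first by case: y y0 yx {xyt le_sh}.
case: y => // y in xyt y0 yx le_sh *.
have [s Es] : {s | size sh = s.+2}.
  exists (size sh).-2; have := le_sh 1%N; have := le_sh 0%N => /=.
  by case: (sh) => [|? [|]] //=; rewrite ?nth_nil.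
have ts : (t <= s)%N.
  case: t le_sh {xyt} => // t /(_ t.+2).
  rewrite nth_near_hook ltnSn => lt; rewrite leqNgt; apply/negP => le.
  by rewrite nth_default ?Es in lt; lia.
have Hx : (y < x -> (nb_fill z (nth 0 [:: x, y.+1 & nseq t 1]))%:R
                    = near_hook x y.+1 t)%N.
  move=> lt; apply: IH; [lia | lia |] => i.
  by apply: leq_trans (le_sh i); case: i => [|[|]] //=.
have Hy y' : (y = y'.+1 -> (nb_fill z (nth 0 [:: x.+1, y & nseq t 1]))%:R
                    = near_hook x.+1 y t)%N.
  move=> lt; apply: IH; [lia | lia |] => i.
  by apply: leq_trans (le_sh i); case: i => [|[|]] //=.
have Ht t' : (t = t'.+1 -> (nb_fill z (nth 0 [:: x.+1, y.+1 & nseq t' 1]))%:R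
                    = near_hook x.+1 y.+1 t')%N.
  move=> lt; apply: IH; [lia | lia |] => i.
  by apply: leq_trans (le_sh i); rewrite !nth_near_hook; case: i => [|[|]] //=; lia.
rewrite branching //; last first.
  by move=> i; rewrite !nth_near_hook; case: i => [|[|i]] //=; lia.
set mu := nth 0%N _.
rewrite big_mkcond /= -(big_mkord xpredT (fun i =>
  if (mu i.+1 < mu i)%N then nb_fill z (decr mu i) else 0%N)) Es.
rewrite !big_nat_recl // addnA !natrD.
have -> : nb_fill z (decr mu 0) = nb_fill z (nth 0%N [:: x, y.+1 & nseq t 1%N]).
  by apply: eq_nb_fill; case=> [|[|]].
have -> : nb_fill z (decr mu 1) = nb_fill z (nth 0%N [:: x.+1, y & nseq t 1%N]).
  by apply: eq_nb_fill; case=> [|[|]].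
have -> : (if (mu 1 < mu 0)%N then nb_fill z (nth 0%N [:: x, y.+1 & nseq t 1%N])
           else 0%N)%:R = near_hook x y.+1 t.
  rewrite /mu /= ltnS; case: ifP => [|/negbT]; first exact: Hx.
  rewrite -leqNgt => le; have -> : y = x by lia.
  by rewrite near_hook_xy.
(* Below the second row [mu] drops only at the end of the leg, in row [t + 1] counted from 0. *)
have E2 : (\sum_(0 <= i < s) if (mu i.+3 < mu i.+2)%N then nb_fill z (decr mu i.+2)
           else 0)%N = if t is t'.+1 then
              nb_fill z (nth 0%N [:: x.+1, y.+1 & nseq t' 1%N]) else 0%N.
  rewrite (eq_bigr (fun i => if i.+1 == t then nb_fill z (decr mu i.+2) else 0%N));
    last first.
    move=> i _; congr (if _ then _ else _).
    by rewrite /mu (nth_near_hook _ _ _ i.+3) (nth_near_hook _ _ _ i.+2); lia.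
  rewrite -big_mkcond; case: t ts @mu {xyt le_sh Hx Hy Ht} => [|t] ts mu.
    by rewrite big_pred0.
  under eq_bigl => i do rewrite eqSS.
  rewrite big_nat1_eq ts; apply: eq_nb_fill => i.
  rewrite /decr /mu !nth_near_hook; case: i => [|[|i]] //.
  by rewrite !eqSS; case: eqVneq => [->|] /=; lia.
rewrite E2 /mu /=.
(* The second row now has [y + 1] cells. If it has one, removing it is possible only for [t = 0] and
   leaves a single row. *)
case: y => [|y] in xyt y0 yx le_sh Hx Hy Ht mu E2 *.
  case: t => [|t] in xyt ts le_sh Hx Hy Ht mu E2 *.
    rewrite ltnS leqnn (@eq_nb_fill _ _ _ (nth 0%N [:: x.+1])); last first.
      by case=> [|[|]] //= i; rewrite nth_nil.
    by rewrite nb_fill_row ?addr0 ?near_hook_rec10 // (le_sh 0%N).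
  by rewrite /= addr0 Ht // near_hook_rec1.
rewrite (_ : (nth 0 (nseq t 1) 0 < y.+2)%N); last first.
  by rewrite nth_nseq; case: ifP.
rewrite (Hy y) //.
case: t => [|t] in xyt ts le_sh Hx Hy Ht mu E2 *.
  by rewrite addr0 near_hook_rec0.
by rewrite Ht // near_hook_rec.
Qed.

Lemma nb_syt_near_hook x y t :
  (0 < y <= x)%N -> (nb_syt [:: x, y & nseq t 1%N])%:R = near_hook x y t.
Proof.
move=> yx; have n0 : (0 < sumn [:: x, y & nseq t 1%N])%N by rewrite /=; lia.
by rewrite -(nb_fill_sh (Ordinal n0) (frefl _)) nb_fill_near_hook.
Qed.

End Counting.

(** * Telescoping and induction on [d] *)

Section Telescoping.
Import Order.TTheory GRing.Theory Num.Theory.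
Local Open Scope ring_scope.

Lemma sum_three_row d k m : (2 <= k)%N -> (4 * d + 4 <= m)%N ->
  \sum_(0 <= j < d.+1) three_row (m - 2 * (d + j + 1)) (k + 2 * d + 1) (k + 2 * j + 1)
  = near_hook (k + 2 * d) k (m - 2 * d)
    - near_hook (k + 2 * d.+1) k (m - 2 * d.+1)
    + near_hook (k + (2 * d).+1) (k + (2 * d).+1) (m - 2 * (2 * d).+1)
    + near_hook (k + (2 * d).+2) (k + (2 * d).+2) (m - 2 * (2 * d).+2).
Proof.
move=> k2 md.
(* In [near_hook_three_row], the two terms with [c.+3] form [u j.+1] and the two with [c.+1] form
   [- u j]. *)
pose u j := near_hook (k + 2 * d).+2 (k + 2 * j) (m - 2 * d - 2 * j - 2)
            - near_hook (k + 2 * d) (k + 2 * j) (m - 2 * d - 2 * j).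
rewrite (eq_big_nat _ _ (F2 := fun j => u j.+1 - u j)) => [|j /andP[_ jd]].
  rewrite telescope_sumr // /u.
  rewrite (_ : k + 2 * d.+1 = (k + 2 * d).+2)%N; last by lia.
  (* At [j = d + 1] the second term of [u] has rows [k + 2d] and [k + 2d + 2]; reflection turns it
     into the square term at [k + 2d + 1]. *)
  rewrite near_hook_antisym muln0 addn0 subn0.
  rewrite (_ : k + (2 * d).+1 = (k + 2 * d).+1)%N; last by lia.
  rewrite (_ : k + (2 * d).+2 = (k + 2 * d).+2)%N; last by lia.
  rewrite (_ : m - 2 * d - 2 * d.+1 = m - 2 * (2 * d).+1)%N; last by lia.
  rewrite (_ : m - 2 * (2 * d).+1 - 2 = m - 2 * (2 * d).+2)%N; last by lia.
  by rewrite (_ : m - 2 * d.+1 = m - 2 * d - 2)%N; [ring | lia].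
(* Possible since [j <= d] and [4 * d + 4 <= m]. *)
have [a Ea] : {a | (m - 2 * (d + j + 1) = a.+2)%N}.
  by exists (m - 2 * (d + j + 1) - 2)%N; lia.
have [b Eb] : {b | (k + 2 * d = b.+1)%N} by exists (k + 2 * d).-1; lia.
have [c Ec] : {c | (k + 2 * j = c.+1)%N} by exists (k + 2 * j).-1; lia.
rewrite Ea Eb Ec !addn1 -near_hook_three_row /u Eb Ec.
rewrite (_ : k + 2 * j.+1 = c.+3)%N; last by lia.
rewrite (_ : m - 2 * d - 2 * j.+1 - 2 = a)%N; last by lia.
rewrite (_ : m - 2 * d - 2 * j.+1 = a.+2)%N; last by lia.
rewrite (_ : m - 2 * d - 2 * j = a.+4)%N; last by lia.
by rewrite subn2 /=; ring.
Qed.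

Lemma sum_near_hook d k m : (2 <= k)%N -> (k + 6 * d <= m + 3)%N ->
  \sum_(0 <= j < (2 * d).+1) near_hook (k + j) (k + j) (m - 2 * j)
  = near_hook (k + 2 * d) k (m - 2 * d)
    + \sum_(0 <= r < d) \sum_(0 <= j < r.+1)
        three_row (m - 2 * (r + j + 1)) (k + 2 * r + 1) (k + 2 * j + 1).
Proof.
move=> k2; elim: d => [|d IH] dm.
  by rewrite muln0 big_nat1 big_geq // addr0 addn0.
rewrite (_ : (2 * d.+1).+1 = (2 * d).+3)%N; last by lia.
rewrite [LHS]big_nat_recr // [X in X + _ = _]big_nat_recr //= IH; last by lia.
(* The bound at [d + 1] together with [2 <= k] gives [6 * d + 5 <= m], hence [4 * d + 4 <= m]. *)
rewrite [X in _ = _ + X]big_nat_recr //= sum_three_row //; [ring | lia].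
Qed.

End Telescoping.

Theorem corollary4p4 (d k m : nat) (hk : 2 <= k) (hm : 2 <= m)
    (hkm : k + 6 * d <= m + 3) :
  L_odd d k m =
    nb_syt [:: k + 2 * d, k & nseq (m - 2 * d) 1] +
    \sum_(0 <= r < d) \sum_(0 <= j < r.+1)
      nb_syt [:: m - 2 * (r + j + 1); k + 2 * r + 1; k + 2 * j + 1].
Proof.
apply/eqP; rewrite -(Num.Theory.eqr_nat rat) GRing.natrD !GRing.natr_sum.
rewrite nb_syt_near_hook; last by lia.
rewrite (eq_bigr (fun j => near_hook (k + j) (k + j) (m - 2 * j))) => [|j _]; last first.
  by rewrite nb_syt_near_hook //; lia.
apply/eqP; rewrite sum_near_hook //; congr (_ + _)%R.
apply: eq_big_nat => r /andP[_ rd]; rewrite GRing.natr_sum.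
(* The tightest case of the partition condition is [r = j = d - 1], where [m - 4d + 2 >= k + 2d - 1]
   is exactly [hkm]. *)
by apply: eq_big_nat => j /andP[_ jr]; rewrite nb_syt_three_row //; lia.
Qed.
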